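(* For every $d \geq 2$, there are exactly $2^{2d-3}$ finitely constrained subgroups of $G=\mathrm{Aut}(X^* )$ that are defined by patterns of size $d$ and have Hausdorff dimension $1 - \frac{2}{2^{d-1}}$.
   Context: Let $X=\{0,1\}$ and let $X^*$ be the set of finite words over $X$, viewed as the rooted binary tree (root the empty word, edges $w\to wx$). $X^n$ denotes the words of length $n$. $G=\mathrm{Aut}(X^* )$ is the group of automorphisms of the rooted binary tree and $G(d)=\mathrm{Aut}(X^{[d]})$ the automorphism group of the finite tree of words of length $\le d$. For $g\in G$ and $w\in X^*$ the section $g_w\in G$ is defined by $g(wv)=g(w)g_w(v)$; for $g\in G(d)$ and $|w|<d$ the finite section $g_w\in G(d-|w|)$ is defined likewise. $\pi_k$ denotes restriction of the action to words of length $\le k$ (from $G$ or from $G(n)$, $n\ge k$, to $G(k)$); for a subgroup $H$, $H(k)=\pi_k(H)$ and $H_k$ is the level-$k$ stabilizer (elements fixing every word of length $k$). A subgroup $P\le G(d)$ is an essential pattern group (of pattern size $d$) if for every $p\in P$ and $i\in\{0,1\}$ there is $q\in P$ with $\pi_{d-1}(q)=p_i$. For such $P$, $G_P=\{g\in G:\pi_d(g_w)\in P\text{ for all }w\in X^*\}$. A subgroup of $G$ is finitely constrained if it equals $G_P$ for some essential pattern group $P$; it is defined by patterns of size $d$ if $d$ is the minimal size of such a $P$. Hausdorff dimension is with respect to the profinite metric on $G$; for a closed subgroup $K$, $\mathrm{Hdim}(K)=\liminf_{n\to\infty}\log_2|K(n)|/\log_2|G(n)|$. *)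

(* Defs.v *)
From Stdlib Require Import Reals ClassicalEpsilon.
From mathcomp Require Import all_boot fingroup perm.

Unset Printing Implicit Defensive.

Fixpoint words (n : nat) : seq (seq bool) :=
  match n with
  | 0 => [:: [::]]
  | n'.+1 => [::] :: [seq b :: w | b <- [:: false; true], w <- words n']
  end.

Definition W (n : nat) := seq_sub (words n).

Definition edge (w u : seq bool) : bool :=
  (u == rcons w false) || (u == rcons w true).

Definition is_aut (g : seq bool -> seq bool) : Prop :=
  bijective g /\ g [::] = [::] /\
  (forall u v, edge u v = edge (g u) (g v)).

(* section g_w : g(wv) = g(w) g_w(v) *)
Definition section (g : seq bool -> seq bool) (w : seq bool) : seq bool -> seq bool :=
  fun v => drop (size w) (g (w ++ v)).

Definition Autd (n : nat) : {set {perm W n}} :=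
  [set p : {perm W n} |
     [forall u : W n, (val u == [::]) ==> (val (p u) == [::])] &&
     [forall u : W n, forall v : W n,
        edge (val u) (val v) == edge (val (p u)) (val (p v))]].

(* restriction to words of length <= n of a map on words, as a permutation
   (for automorphisms this is exactly the restriction pi_n) *)
Definition restr_fun (n : nat) (f : seq bool -> seq bool) (w : W n) : W n :=
  odflt w (insub (f (val w))).

Definition mkperm (n : nat) (f : seq bool -> seq bool) : {perm W n} :=
  (if injectiveb (@restr_fun n f) as b
      return injectiveb (@restr_fun n f) = b -> {perm W n}
   then fun h => perm (elimT (injectiveP _) h)
   else fun _ => 1%g) (erefl _).

Definition ext (n : nat) (p : {perm W n}) (s : seq bool) : seq bool :=
  if @insub _ (fun x => x \in words n) (W n) s is Some w then val (p w) else s.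

(* for p in G(d): pi_{d-1}(q) = mkperm d.-1 (ext d q),
   finite section p_x = mkperm d.-1 (section (ext d p) [:: x]) *)
Definition essential (d : nat) (P : {set {perm W d}}) : Prop :=
  (0 < d)%N /\
  forall p, p \in P -> forall x : bool,
    exists2 q, q \in P &
      mkperm d.-1 (ext d q) = mkperm d.-1 (section (ext d p) [:: x]).

Definition GP (d : nat) (P : {set {perm W d}}) (g : seq bool -> seq bool) : Prop :=
  is_aut g /\ forall w : seq bool, mkperm d (section g w) \in P.

Definition subsetG := (seq bool -> seq bool) -> Prop.

Definition defined_by (d : nat) (H : subsetG) : Prop :=
  exists P : {group {perm W d}},
    P \subset Autd d /\ essential d P /\ (forall g, H g <-> GP d P g).

Definition FC_size (d : nat) (H : subsetG) : Prop :=
  defined_by d H /\ forall d', (d' < d)%N -> ~ defined_by d' H.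

Definition pb (P : Prop) : bool :=
  if excluded_middle_informative P then true else false.

Definition cardH (n : nat) (H : subsetG) : nat :=
  #|[set p : {perm W n} | pb (exists g, H g /\ mkperm n g = p)]|.

Definition log2 (x : R) : R := Rdiv (ln x) (ln 2).

Definition is_liminf (u : nat -> R) (l : R) : Prop :=
  (forall eps : R, Rlt 0 eps -> exists N : nat, forall n : nat, (N <= n)%N -> Rlt (Rminus l eps) (u n)) /\
  (forall eps : R, Rlt 0 eps -> forall N : nat, exists n : nat, (N <= n)%N /\ Rlt (u n) (Rplus l eps)).

Definition Hdim_is (H : subsetG) (l : R) : Prop :=
  is_liminf (fun n => Rdiv (log2 (INR (cardH n H))) (log2 (INR #|Autd n|))) l.

(* Main.v *)
Require Import Defs.
From Stdlib Require Import Reals.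
From mathcomp Require Import all_boot fingroup perm.
From Stdlib Require Import Lra ClassicalEpsilon.
From mathcomp Require Import morphism quotient pgroup commutator gseries cyclic maximal.

Set Implicit Arguments.
Unset Strict Implicit.

(** An automorphism is the same as a labelling [f] of the words by bits, the
    label at [w] telling whether it swaps the two children of [w].
    For [H = G_P] with [P] of size [d], the kernels of [H(n+1) -> H(n)] have
    order [k^(2^(n-d+1))] for [n >= d-1], where [k] is the order of the kernel
    of [P = H(d) -> H(d-1)]; hence [Hdim H = log2 k / 2^(d-1)], and the
    dimension in question means that this kernel has index 4 in [F_2^(2^(d-1))].
    The kernel of [H(d-1) -> H(d-2)] is then everything, since otherwise the
    kernel orders show that [H] is already defined by patterns of size [d-1];
    so [P] has index 4 in [Aut(d)] and maps onto [Aut(d-1)].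
    Write [s_k] for the parity of the number of swaps on level [k]; the [s_k]
    span the homomorphisms from [Aut(n)] to [F_2]. The subgroups of this kind
    are exactly the
      [s_(d-2)(p_x) = sum_(k < d-2) (a_k s_k(p_x) + b_k s_k(p_(1-x))) + e r(p)]
    for [x = 0, 1], where [r(p)] tells whether [p] swaps the first letter;
    the bits [a_k], [b_k], [e] are arbitrary and determined by the group.
    The proof that there are no others uses that an index 4 subgroup of a
    2-group contains the commutators of some intermediate subgroup of index 2. *)

(** * Portraits *)

Lemma mem_words n w : (w \in words n) = (size w <= n).
Proof.
elim: n w => [|n IH] [|x v] //=; rewrite inE /=; apply/idP/idP.
- rewrite !mem_cat in_nil orbF.
  by case/orP=> /mapP[u]; rewrite IH => hu [_ ->].
- move=> hv; rewrite !mem_cat in_nil orbF.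
  by case: x; apply/orP; [right|left]; apply: map_f; rewrite IH.
Qed.

Lemma sizeW n (w : W n) : size (val w) <= n.
Proof. by rewrite -mem_words; exact: valP. Qed.

Definition mkW n w (h : size w <= n) : W n := SeqSub (etrans (mem_words n w) h).

(* The portrait [f] stands for the automorphism [act f], characterized by
   [act f (rcons w b) = rcons (act f w) (b (+) f w)]; [sh] and [shw] give the
   portraits of its sections. *)
Definition lab := seq bool -> bool.
Definition lab1 : lab := fun=> false.
Definition sh (x : bool) (f : lab) : lab := fun u => f (x :: u).
Definition shw (w : seq bool) (f : lab) : lab := fun u => f (w ++ u).

Fixpoint act (f : lab) (w : seq bool) : seq bool :=
  if w is x :: v then (x (+) f [::]) :: act (sh x f) v else [::].

Fixpoint iact (f : lab) (w : seq bool) : seq bool :=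
  if w is y :: v then (y (+) f [::]) :: iact (sh (y (+) f [::]) f) v else [::].

(* Portrait of [act g \o act f]: as for permutations, the left factor acts first. *)
Definition lmul (f g : lab) : lab := fun w => f w (+) g (act f w).

(** The strict bound fits [mk_eqP]: labels at words shorter than [n] decide the action on words of
    length up to [n]. *)
Definition agree n (f g : lab) := forall w, size w < n -> f w = g w.

Lemma agree_sym n f g : agree n f g -> agree n g f.
Proof. by move=> h w /h. Qed.

Lemma agree_trans n f g h : agree n f g -> agree n g h -> agree n f h.
Proof. by move=> h1 h2 w hw; rewrite h1 ?h2. Qed.

Lemma agreeW m n f g : m <= n -> agree n f g -> agree m f g.
Proof. by move=> hm h w hw; apply: h; apply: leq_trans hm. Qed.

Lemma agree_sh n f g x : agree n.+1 f g -> agree n (sh x f) (sh x g).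
Proof. by move=> h w hw; apply: h. Qed.

Lemma size_act f w : size (act f w) = size w.
Proof. by elim: w f => //= x v IH f; rewrite IH. Qed.

Lemma act_lmul f g w : act (lmul f g) w = act g (act f w).
Proof. by elim: w f g => //= x v IH f g; rewrite /lmul /= addbA -IH. Qed.

Lemma actK f : cancel (act f) (iact f).
Proof. by move=> w; elim: w f => //= x v IH f; rewrite addbK IH. Qed.

Lemma iactK f : cancel (iact f) (act f).
Proof. by move=> w; elim: w f => //= x v IH f; rewrite addbK IH. Qed.

Lemma act_inj f : injective (act f).
Proof. exact: can_inj (actK f). Qed.

Lemma act_agree n f g w : agree n f g -> size w <= n -> act f w = act g w.
Proof.
elim: w n f g => //= x v IH [//|n] f g h hv.
by rewrite (h [::]) // (IH n _ (sh x g)) //; apply: agree_sh.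
Qed.

Lemma act_lab1 w : act lab1 w = w.
Proof. by elim: w => //= x v IH; rewrite addbF IH. Qed.

Lemma act_small n f w : agree n f lab1 -> size w <= n -> act f w = w.
Proof. by move=> h hw; rewrite (act_agree h hw) act_lab1. Qed.

Lemma act_cat f w v : act f (w ++ v) = act f w ++ act (shw w f) v.
Proof. by elim: w f => //= x w IH f; rewrite IH. Qed.

Lemma act_rcons f w b : act f (rcons w b) = rcons (act f w) (b (+) f w).
Proof. by rewrite -cats1 act_cat /= /shw cats0 cats1. Qed.

Lemma section_act f w v : section (act f) w v = act (shw w f) v.
Proof. by rewrite /section act_cat drop_size_cat ?size_act. Qed.

Lemma agree_lmul n f f' g g' :
  agree n f f' -> agree n g g' -> agree n (lmul f g) (lmul f' g').
Proof.
move=> hf hg w hw; rewrite /lmul hf // (act_agree hf (ltnW hw)) hg //.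
by rewrite size_act.
Qed.

Lemma lmulA f g h w : lmul (lmul f g) h w = lmul f (lmul g h) w.
Proof. by rewrite /lmul addbA -act_lmul. Qed.

Lemma edgeP w u : reflect (exists b, u = rcons w b) (edge w u).
Proof.
apply: (iffP orP) => [[/eqP->|/eqP->]|[[] ->]]; rewrite ?eqxx; try by [left|right].
- by exists false.
- by exists true.
Qed.

Lemma edge_act f u v : edge (act f u) (act f v) = edge u v.
Proof.
apply/edgeP/edgeP=> [[b hb]|[b ->]]; last by exists (b (+) f u); rewrite act_rcons.
exists (b (+) f u); apply: (@act_inj f).
by rewrite hb act_rcons addbK.
Qed.

Lemma act_is_aut g f : g =1 act f -> is_aut g.
Proof.
move=> e; split; first by exists (iact f) => w; rewrite ?e ?actK ?iactK.
by split=> [|u v]; rewrite !e ?edge_act.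
Qed.

(** An automorphism with label $b$ at $w$ sends $w0$ to a word ending in $b$. *)
Definition labf (g : seq bool -> seq bool) : lab :=
  fun w => last false (g (rcons w false)).

(** The bound [n] lets this serve both automorphisms of the whole tree and permutations of [W n]. By
    injectivity the two children of [w] go to distinct children of [g w], so the image of one of
    them fixes the label. *)
Lemma edge_labf n (g : seq bool -> seq bool) : g [::] = [::] ->
  (forall u v, size u <= n -> size v <= n -> g u = g v -> u = v) ->
  (forall u v, size u <= n -> size v <= n -> edge u v -> edge (g u) (g v)) ->
  forall w, size w <= n -> g w = act (labf g) w.
Proof.
move=> g0 ginj gedge; elim/last_ind => [//|w b IH].
rewrite size_rcons => hw.
have E c : exists c', g (rcons w c) = rcons (g w) c'.
  apply/edgeP; apply: gedge; rewrite ?size_rcons //; first exact: ltnW.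
  by apply/edgeP; exists c.
rewrite act_rcons -IH ?(ltnW hw) // /labf.
have [c0 e0] := E false; have [c1 e1] := E true.
rewrite e0 last_rcons; case: b; last by rewrite e0.
rewrite e1; case: (eqVneq c0 c1) => [cc|]; last by case: c0 e0; case: c1 e1.
have: rcons w false = rcons w true by apply: ginj; rewrite ?size_rcons // e0 e1 cc.
by move/(congr1 (last false)); rewrite !last_rcons.
Qed.

Lemma is_aut_act g : is_aut g -> g =1 act (labf g).
Proof.
case=> [/bij_inj ginj [g0 ge]] w; apply: (@edge_labf (size w)) => // u v _ _.
- by move/ginj.
- by rewrite ge.
Qed.

Lemma mkpermE n f : injective (@restr_fun n f) -> mkperm n f =1 @restr_fun n f.
Proof.
move=> inj w; rewrite /mkperm.
move: (erefl (injectiveb (@restr_fun n f))).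
case: {2 3}(injectiveb _) => [h|h]; first by rewrite permE.
by case/negP: (negbT h); apply/injectiveP.
Qed.

Definition mk n (f : lab) : {perm W n} := mkperm n (act f).

Lemma val_restr n g (w : W n) : size (g (val w)) <= n ->
  val (@restr_fun n g w) = g (val w).
Proof. by move=> h; rewrite /restr_fun; case: insubP => [u _ ->|]; rewrite ?mem_words ?h. Qed.

Lemma val_mkperm n f g (w : W n) :
  (forall v, size v <= n -> g v = act f v) -> val (mkperm n g w) = act f (val w).
Proof.
move=> e; have E (v : W n) : val (@restr_fun n g v) = act f (val v).
  by rewrite val_restr e ?size_act ?sizeW.
rewrite mkpermE // => u v /(congr1 val); rewrite !E => /act_inj; exact: val_inj.
Qed.

Lemma val_mk n f (w : W n) : val (mk n f w) = act f (val w).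
Proof. exact: val_mkperm. Qed.

Lemma mkperm_mk n f g :
  (forall v, size v <= n -> g v = act f v) -> mkperm n g = mk n f.
Proof. by move=> e; apply/permP=> w; apply: val_inj; rewrite val_mk (val_mkperm _ e). Qed.

Lemma mk_eqP n f g : mk n f = mk n g <-> agree n f g.
Proof.
split=> [e w hw|e]; last first.
  by apply: mkperm_mk => v hv; apply: act_agree hv.
have hw' : size (rcons w false) <= n by rewrite size_rcons.
have /(congr1 val) := congr1 (fun p : {perm W n} => p (mkW hw')) e.
by rewrite !val_mk /= !act_rcons => /(congr1 (last false)); rewrite !last_rcons.
Qed.

Lemma mk1 n : mk n lab1 = 1%g.
Proof. by apply/permP=> w; apply: val_inj; rewrite val_mk act_lab1 perm1. Qed.

Lemma mkM n f g : mk n (lmul f g) = (mk n f * mk n g)%g.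
Proof. by apply/permP=> w; apply: val_inj; rewrite permM !val_mk act_lmul. Qed.

Lemma ext_mk n f w : size w <= n -> ext n (mk n f) w = act f w.
Proof. by move=> h; rewrite /ext (insubT (fun x => x \in words n)) ?mem_words // => h'; rewrite val_mk. Qed.

Lemma restr_mk m n f : m <= n -> mkperm m (ext n (mk n f)) = mk m f.
Proof. by move=> h; apply: mkperm_mk => v hv; rewrite ext_mk // (leq_trans hv). Qed.

Lemma sec_mk n f x : mkperm n (section (ext n.+1 (mk n.+1 f)) [:: x]) = mk n (sh x f).
Proof. by apply: mkperm_mk => v hv; rewrite /section cat1s ext_mk //= drop0. Qed.

Lemma mk_section n f g w : g =1 act f -> mkperm n (section g w) = mk n (shw w f).
Proof. by move=> e; apply: mkperm_mk => v _; rewrite /section e -section_act. Qed.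

Lemma AutdP n p : reflect (exists f, mk n f = p) (p \in Autd n).
Proof.
rewrite inE; apply: (iffP andP) => [[/forallP h0 /forallP he]|[f <-]]; last first.
  split; apply/forallP=> u; first by apply/implyP=> /eqP; rewrite val_mk => ->.
  by apply/forallP=> v; rewrite !val_mk edge_act.
have E w (h : size w <= n) : ext n p w = val (p (mkW h)).
  rewrite /ext (insubT (fun x => x \in words n)) ?mem_words // => h'.
  by congr (val (p _)); apply: val_inj.
exists (labf (ext n p)); apply/permP=> w; apply: val_inj; rewrite val_mk.
have /esym -> // : ext n p (val w) = act (labf (ext n p)) (val w).
  apply: (@edge_labf n); rewrite ?sizeW //.
  - have h : size (@nil bool) <= n by [].
    by rewrite (E _ h); have /implyP/(_ isT)/eqP := h0 (mkW h).
  - by move=> u v hu hv; rewrite (E _ hu) (E _ hv) => /val_inj/perm_inj/(congr1 val).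
  - move=> u v hu hv; rewrite (E _ hu) (E _ hv).
    by have /forallP/(_ (mkW hv))/eqP <- := he (mkW hu).
rewrite (E _ (sizeW w)); congr (val (p _)); exact: val_inj.
Qed.

(** * Counting restrictions *)

Lemma pbP P : reflect P (pb P).
Proof. by rewrite /pb; case: excluded_middle_informative => h; constructor. Qed.

(** The notation $C(n)=\pi_n(C)$, for a set $C$ of portraits. *)
Definition img n (C : lab -> Prop) : {set {perm W n}} :=
  [set p | pb (exists f, C f /\ mk n f = p)].

Lemma imgP n C p : reflect (exists2 f, C f & mk n f = p) (p \in img n C).
Proof.
rewrite inE; apply: (iffP (pbP _)) => [[f [h1 h2]]|[f h1 h2]]; first by exists f.
by exists f.
Qed.

Lemma mem_img n (C : lab -> Prop) f : C f -> mk n f \in img n C.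
Proof. by move=> h; apply/imgP; exists f. Qed.

Lemma img_sub n (C D : lab -> Prop) : (forall f, C f -> D f) -> img n C \subset img n D.
Proof. by move=> h; apply/subsetP=> p /imgP[f /h hf <-]; apply: mem_img. Qed.

Definition all_lab : lab -> Prop := fun=> True.

Lemma img_all n : img n all_lab = Autd n.
Proof. by apply/setP=> p; apply/imgP/AutdP => [[f _ e]|[f e]]; exists f. Qed.

Lemma img_Autd n C : img n C \subset Autd n.
Proof. by rewrite -img_all; apply: img_sub. Qed.

Definition submon (C : lab -> Prop) := C lab1 /\ forall f g, C f -> C g -> C (lmul f g).

Lemma img_group_set n C : submon C -> group_set (img n C).
Proof.
case=> h1 hM; apply/group_setP; split; first by rewrite -mk1; apply: mem_img.
by move=> _ _ /imgP[f hf <-] /imgP[g hg <-]; rewrite -mkM; apply/mem_img/hM.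
Qed.

Lemma submon_all : submon all_lab. Proof. by []. Qed.

Definition stab n (C : lab -> Prop) : lab -> Prop := fun f => C f /\ agree n f lab1.

Lemma submon_stab n C : submon C -> submon (stab n C).
Proof.
move=> [h1 hM]; split=> // f g [hf ef] [hg eg]; split; first exact: hM.
by move=> w hw; rewrite (agree_lmul ef eg).
Qed.

Definition res n (p : {perm W n.+1}) : {perm W n} := mkperm n (ext n.+1 p).

Lemma res_mk n f : res (mk n.+1 f) = mk n f.
Proof. exact: restr_mk. Qed.

(** This is the kernel of $C(n+1)\to C(n)$. It depends only on [img n.+1 C], which later allows
    exchanging sets with the same image. *)
Lemma img_stab n C : img n.+1 (stab n C) = [set p in img n.+1 C | res p == 1%g].
Proof.
apply/setP=> p; rewrite inE; apply/imgP/andP=> [[f [hf ef] <-]|[/imgP[f hf <-]]].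
  by split; [exact: mem_img | rewrite res_mk -mk1; apply/eqP/mk_eqP].
by rewrite res_mk -mk1 => /eqP/mk_eqP e; exists f.
Qed.

Lemma card_img_succ n C : submon C ->
  #|img n.+1 C| = #|img n C| * #|img n.+1 (stab n C)|.
Proof.
move=> hC; pose G := Group (img_group_set n.+1 hC).
have rM : {in G &, {morph @res n : x y / (x * y)%g}}.
  by move=> _ _ /imgP[f _ <-] /imgP[g _ <-]; rewrite -mkM !res_mk mkM.
pose r := Morphism rM.
have -> : img n C = (r @* G)%g.
  rewrite morphimEsub //; apply/setP=> p; apply/imgP/imsetP=> [[f hf <-]|].
    by exists (mk n.+1 f); [exact: mem_img | rewrite /= res_mk].
  by case=> _ /imgP[f hf <-] ->; exists f; rewrite /= ?res_mk.
have -> : img n.+1 (stab n C) = ('ker r)%g.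
  by rewrite img_stab; apply/setP=> p; rewrite !inE.
by rewrite card_morphim setIid mulnC Lagrange //; apply: subsetIl.
Qed.

Definition sec n x (p : {perm W n.+1}) : {perm W n} :=
  mkperm n (section (ext n.+1 p) [:: x]).

Definition node (r : bool) (f0 f1 : lab) : lab :=
  fun u => if u is x :: v then (if x then f1 v else f0 v) else r.

Definition self_similar (C : lab -> Prop) := forall f x, C f -> C (sh x f).

(** The root label is trivial here, so the two sections tell everything. *)
Lemma sec_stab_inj n C :
  {in img n.+2 (stab n.+1 C) &, injective (fun p => (sec false p, sec true p))}.
Proof.
move=> _ _ /imgP[f [_ ef] <-] /imgP[g [_ eg] <-] [].
rewrite /sec !sec_mk => /mk_eqP e0 /mk_eqP e1; apply/mk_eqP=> [] [|[] v] hv.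
- by rewrite ef ?eg.
- exact: e1.
- exact: e0.
Qed.

Lemma sec_stab_sub n (C D : lab -> Prop) : (forall f x, C f -> D (sh x f)) ->
  [set (sec false p, sec true p) | p in img n.+2 (stab n.+1 C)] \subset
  setX (img n.+1 (stab n D)) (img n.+1 (stab n D)).
Proof.
move=> hC; apply/subsetP=> _ /imsetP[_ /imgP[f [hf ef] <-] ->].
by rewrite /sec !sec_mk inE; apply/andP; split; apply: mem_img; split;
  try exact: hC; exact: (agree_sh _ ef).
Qed.

Lemma card_stab_le n (C D : lab -> Prop) : (forall f x, C f -> D (sh x f)) ->
  #|img n.+2 (stab n.+1 C)| <= #|img n.+1 (stab n D)| ^ 2.
Proof.
move=> hC; rewrite -(card_in_imset (@sec_stab_inj n C)) -mulnn -cardsX.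
exact/subset_leq_card/sec_stab_sub.
Qed.

(** When sections can be glued freely, the embedding behind [card_stab_le] is onto. [D] differs from
    [C] in [card_stab_twisted], where each section is constrained separately. *)
Lemma card_stab_eq n (C D : lab -> Prop) : (forall f x, C f -> D (sh x f)) ->
  (forall f g, stab n D f -> stab n D g -> C (node false f g)) ->
  #|img n.+2 (stab n.+1 C)| = #|img n.+1 (stab n D)| ^ 2.
Proof.
move=> hC hN; rewrite -(card_in_imset (@sec_stab_inj n C)) -mulnn -cardsX.
apply: eq_card => p; apply/idP/idP; first by move/(subsetP (sec_stab_sub n hC)).
case: p => _ _ /setXP[/imgP[f hf <-] /imgP[g hg <-]].
apply/imsetP; exists (mk n.+2 (node false f g)); last by rewrite /sec !sec_mk.
apply: mem_img; split; first exact: hN.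
case: hf hg => _ ef [_ eg] [|[] v] hv //; [exact: eg | exact: ef].
Qed.

Lemma card_stab0_all : #|img 1 (stab 0 all_lab)| = 2.
Proof.
have -> : img 1 (stab 0 all_lab) = [set mk 1 lab1; mk 1 (fun=> true)].
  apply/setP=> p; rewrite !inE; apply/pbP/orP=> [[f [_ <-]]|].
    case e: (f [::]); [right|left]; apply/eqP/mk_eqP=> [] [] //.
  by case=> /eqP->; eexists; (split; last reflexivity).
by rewrite cards2 (_ : (_ != _) = true) //; apply/eqP=> /mk_eqP/(_ [::] isT).
Qed.

Lemma card_stab_all n : #|img n.+1 (stab n all_lab)| = 2 ^ 2 ^ n.
Proof.
elim: n => [|n IH]; first exact: card_stab0_all.
by rewrite (@card_stab_eq n _ all_lab) // IH -expnM -expnSr.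
Qed.

Lemma card_Autd n : #|Autd n| = 2 ^ (2 ^ n - 1).
Proof.
rewrite -img_all; elim: n => [|n IH].
  by apply/eqP/cards1P; exists 1%g; apply/setP=> p; rewrite inE; apply/imgP/eqP=> [[f _ <-]|->];
    [rewrite -mk1; apply/mk_eqP | exists lab1; rewrite ?mk1].
rewrite card_img_succ // IH card_stab_all -expnD expnS mul2n -addnn.
by rewrite addnBAC // expn_gt0.
Qed.

(** * Growth of the level kernels *)

Section Growth.
Variables (m : nat) (C : lab -> Prop).
Hypotheses (hC : submon C) (sC : self_similar C)
  (hN : forall n f g, m <= n -> stab n C f -> stab n C g -> C (node false f g)).

Lemma card_stab_growth j :
  #|img (m + j).+1 (stab (m + j) C)| = #|img m.+1 (stab m C)| ^ 2 ^ j.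
Proof.
elim: j => [|j IH]; first by rewrite addn0.
rewrite addnS (@card_stab_eq _ _ C) // ?IH -?expnM ?expnSr // => f g.
exact/hN/leq_addr.
Qed.

(** The exponents add up to $1+2+\dots+2^{j-1}$. *)
Lemma card_img_growth j :
  #|img (m + j) C| = #|img m C| * #|img m.+1 (stab m C)| ^ (2 ^ j - 1).
Proof.
elim: j => [|j IH]; first by rewrite addn0 muln1.
rewrite addnS card_img_succ // IH card_stab_growth -mulnA -expnD; congr (_ * _ ^ _).
by rewrite expnS mul2n -addnn addnBAC // expn_gt0.
Qed.
End Growth.

(** * Finitely constrained groups in terms of portraits *)

Section Pattern.
Variables (d : nat) (P : {group {perm W d}}).
Hypothesis sP : P \subset Autd d.

Definition HP (f : lab) := forall w, mk d (shw w f) \in P.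

Lemma shw_lmul w f g v :
  shw w (lmul f g) v = lmul (shw w f) (shw (act f w) g) v.
Proof. by rewrite /shw /lmul act_cat. Qed.

Lemma submon_HP : submon HP.
Proof.
split=> [w|f g hf hg w]; first by rewrite -[shw w lab1]/lab1 mk1 group1.
have -> : mk d (shw w (lmul f g)) = mk d (lmul (shw w f) (shw (act f w) g)).
  by apply/mk_eqP=> v _; rewrite shw_lmul.
by rewrite mkM; apply: groupM; [exact: hf | exact: hg].
Qed.

Lemma HP_shw w f : HP f -> HP (shw w f).
Proof.
move=> h v; have -> : mk d (shw v (shw w f)) = mk d (shw (w ++ v) f) by
  apply/mk_eqP=> u _; rewrite /shw catA.
exact: h.
Qed.

Lemma HP_sh : self_similar HP.
Proof. by move=> f x; exact: (@HP_shw [:: x]). Qed.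

(** As [d <= n.+1], the pattern at the root sees only trivial labels; every other pattern belongs to
    [f] or [g]. *)
Lemma HP_node n f g : d <= n.+1 -> stab n HP f -> stab n HP g -> HP (node false f g).
Proof.
move=> hd [hf ef] [hg eg] [|[] w]; [|exact: hg|exact: hf].
have -> : mk d (shw [::] (node false f g)) = mk d lab1; last by rewrite mk1.
apply/mk_eqP=> u hu; have: size u < n.+1 by apply: leq_trans hd.
by case: u {hu} => [|[] u] //; [exact: eg|exact: ef].
Qed.

Lemma GP_HP g : GP d P g <-> exists2 f, HP f & g =1 act f.
Proof.
split=> [[ha h]|[f hf e]].
  exists (labf g); last exact: is_aut_act ha.
  by move=> w; rewrite -(mk_section d w (is_aut_act ha)); exact: h.
by split; [exact: act_is_aut e | move=> w; rewrite (mk_section d w e); exact: hf].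
Qed.

Lemma GP_act f : GP d P (act f) <-> HP f.
Proof.
split=> [[_ h] w|h]; last by apply/GP_HP; exists f.
by rewrite -(mk_section d w (frefl _)); exact: h.
Qed.

Lemma cardH_GP H n : (forall g, H g <-> GP d P g) -> cardH n H = #|img n HP|.
Proof.
move=> hH; apply: eq_card => p; rewrite [LHS]inE; apply/pbP/imgP.
- case=> g [/hH/GP_HP[f hf e] <-]; exists f => //.
  by apply/esym/mkperm_mk=> v _.
- by case=> f /GP_act/hH hf <-; exists (act f).
Qed.

Lemma essentialP : essential d P <->
  0 < d /\ forall f, mk d f \in P -> forall x,
    exists2 g, mk d g \in P & agree d.-1 g (sh x f).
Proof.
split=> -[d0 h]; split=> //; case: d P sP d0 h => // m Q sQ _ h.
- move=> f hf x; have [q hq] := h _ hf x; rewrite sec_mk.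
  have /AutdP[g eg] := subsetP sQ _ hq; rewrite -eg in hq *.
  by rewrite restr_mk // => /mk_eqP; exists g.
- move=> p hp x; have /AutdP[f ef] := subsetP sQ _ hp; rewrite -ef in hp *.
  have [g hg e] := h _ hp x; exists (mk m.+1 g) => //.
  by rewrite sec_mk restr_mk //; apply/mk_eqP.
Qed.

Lemma img_HP_sub : img d HP \subset P.
Proof. by apply/subsetP=> _ /imgP[f /(_ [::]) hf <-]. Qed.

(** Essentiality lets every pattern of [P] grow to an element of $G_P$: at each child place a
    pattern of [P] that prolongs the section, and repeat. *)
Lemma img_HP : essential d P -> img d HP = P.
Proof.
case/essentialP=> d0 hE; apply/eqP; rewrite eqEsubset img_HP_sub /=.
pose e (f : lab) x := epsilon (inhabits lab1)
  (fun g => mk d g \in P /\ agree d.-1 g (sh x f)).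
have eP f x : mk d f \in P -> mk d (e f x) \in P /\ agree d.-1 (e f x) (sh x f).
  by move=> hf; apply: (epsilon_spec (inhabits lab1)
    (fun g => mk d g \in P /\ agree d.-1 g (sh x f))); have [g ? ?] := hE f hf x; exists g.
(* [Q f w] is the pattern placed at [w]; the root labels of these patterns form the required
   portrait. *)
pose Q := fix Q (f : lab) (w : seq bool) : lab := if w is x :: v then Q (e f x) v else f.
have Q_P w : forall f, mk d f \in P -> mk d (Q f w) \in P.
  by elim: w => [|x w IH] f //= /(eP f x)[/IH].
have Q_cat w v : forall f, Q f (w ++ v) = Q (Q f w) v.
  by elim: w => [|x w IH] f /=.
have Q_nil v : forall f, mk d f \in P -> size v < d -> Q f v [::] = f v.
  elim: v => [|x v IH] f //= /(eP f x)[h1 h2] hv.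
  by rewrite IH ?(ltnW hv) // h2 //; case: (d) d0 hv.
apply/subsetP=> p hp; have /AutdP[f ef] := subsetP sP _ hp; rewrite -{}ef in hp *.
apply/imgP; exists (fun w => Q f w [::]); last by apply/mk_eqP=> w; exact: Q_nil.
move=> w; rewrite (_ : mk d _ = mk d (Q f w)) ?Q_P //.
by apply/mk_eqP=> v hv; rewrite /shw Q_cat Q_nil ?Q_P.
Qed.
End Pattern.

(** * Hausdorff dimension *)

Lemma INR_expn a b : INR (a ^ b) = pow (INR a) b.
Proof. by elim: b => [|b IH] //; rewrite expnS -multE mult_INR IH. Qed.

Lemma ln2_pos : Rlt 0 (ln 2).
Proof. rewrite -ln_1; apply: ln_increasing; lra. Qed.

Lemma log2_mul x y : Rlt 0 x -> Rlt 0 y -> log2 (Rmult x y) = Rplus (log2 x) (log2 y).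
Proof. move=> hx hy; rewrite /log2 ln_mult //; field; have := ln2_pos; lra. Qed.

Lemma log2_pow x n : Rlt 0 x -> log2 (pow x n) = Rmult (INR n) (log2 x).
Proof. move=> hx; rewrite /log2 ln_pow //; field; have := ln2_pos; lra. Qed.

Lemma log2_2 : log2 2 = IZR 1.
Proof. rewrite /log2; field; have := ln2_pos; lra. Qed.

Lemma log2_inj x y : Rlt 0 x -> Rlt 0 y -> log2 x = log2 y -> x = y.
Proof.
move=> hx hy e; apply: ln_inv => //; have h := ln2_pos.
have -> : ln x = Rmult (log2 x) (ln 2) by rewrite /log2; field; lra.
by rewrite e /log2; field; lra.
Qed.

Lemma INR_pos n : 0 < n -> Rlt 0 (INR n).
Proof. by move=> h; apply: lt_0_INR; apply/ltP. Qed.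

Lemma liminf_uniq u l l' : is_liminf u l -> is_liminf u l' -> l = l'.
Proof.
have aux a b : is_liminf u a -> is_liminf u b -> ~ Rlt a b.
  move=> [_ h1] [h2 _] hab; pose e := Rdiv (Rminus b a) 2.
  have e0 : Rlt 0 e by rewrite /e; lra.
  have [N hN] := h2 e e0; have [n [hn hu]] := h1 e e0 N.
  have := hN n hn; rewrite /e in hu *; lra.
by move=> h h'; have := aux _ _ h h'; have := aux _ _ h' h; lra.
Qed.

Lemma INR_2 : INR 2 = IZR 2. Proof. by []. Qed.

Lemma INR_pow2_pred n : INR (2 ^ n - 1) = Rminus (pow 2 n) 1.
Proof. by rewrite -minusE minus_INR ?INR_expn //; apply/leP; rewrite expn_gt0. Qed.

Lemma pow2_ge n : Rle (INR n) (Rminus (pow 2 n) 1).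
Proof.
rewrite -INR_pow2_pred; apply: le_INR; apply/leP.
by rewrite leq_subRL ?expn_gt0 // add1n ltn_expl.
Qed.

(** From [m] on, [u n] is [b / 2 ^ m] plus a constant multiple of [1 / (2 ^ n - 1)], so it even
    converges. *)
Lemma liminf_growth u (m : nat) (a b : R) :
  (forall j, u (m + j) = Rdiv (Rplus a (Rmult (Rminus (pow 2 j) 1) b))
                            (Rminus (pow 2 (m + j)) 1)) ->
  is_liminf u (Rdiv b (pow 2 m)).
Proof.
move=> hu; pose D := Rplus (Rminus a b) (Rdiv b (pow 2 m)).
have hM : Rlt 0 (pow 2 m) by apply: pow_lt; lra.
have E n : m <= n -> 0 < n ->
    u n = Rplus (Rdiv b (pow 2 m)) (Rdiv D (Rminus (pow 2 n) 1)).
  move=> hn n0; rewrite -(subnKC hn) hu /D subnKC //.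
  have h := pow2_ge n; have h0 := INR_pos n0.
  have e : pow 2 n = Rmult (pow 2 m) (pow 2 (n - m)).
    by rewrite -Rdef_pow_add plusE subnKC.
  by rewrite e in h *; field; split; lra.
have close eps : Rlt 0 eps -> exists N, forall n, N <= n ->
    Rlt (Rabs (Rminus (u n) (Rdiv b (pow 2 m)))) eps.
  move=> he; have [N hN] := INR_unbounded (Rdiv (Rabs D) eps).
  exists (maxn 1 (maxn m N)) => n; rewrite !geq_max => /and3P[n0 hm hNn].
  rewrite E //; have -> x y : Rminus (Rplus x y) x = y by ring.
  have h1 := pow2_ge n; have h0 := INR_pos n0.
  have h2 : Rle (INR N) (INR n) by apply: le_INR; apply/leP.
  rewrite /Rdiv Rabs_mult Rabs_inv (Rabs_pos_eq (Rminus _ _)); last lra.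
  apply: (Rmult_lt_reg_r (Rminus (pow 2 n) 1)); first lra.
  rewrite Rmult_assoc Rinv_l; last lra.
  have h3 : Rlt (Rabs D) (Rmult (INR N) eps).
    by apply: (Rmult_lt_reg_r (/ eps)); [exact: Rinv_0_lt_compat | rewrite Rmult_assoc Rinv_r; lra].
  have : Rle (Rmult (INR N) eps) (Rmult (Rminus (pow 2 n) 1) eps).
    by apply: Rmult_le_compat_r; lra.
  lra.
split=> eps he; have [N hN] := close _ he.
  exists N => n hn; have := hN n hn => /Rabs_def2; lra.
move=> N'; exists (maxn N N'); split; first exact: leq_maxr.
by have /Rabs_def2 := hN _ (leq_maxl N N'); lra.
Qed.

Lemma card_img_gt0 n C : submon C -> 0 < #|img n C|.
Proof. by move=> [h _]; apply/card_gt0P; exists (mk n lab1); apply: mem_img. Qed.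

(** Sections glue freely from level [d.-1] on, so [card_img_growth] applies, while
    $\log_2|G(n)|=2^n-1$. *)
Lemma Hdim_GP d (P : {group {perm W d}}) H : P \subset Autd d -> essential d P ->
  (forall g, H g <-> GP d P g) ->
  Hdim_is H (Rdiv (log2 (INR #|img d.-1.+1 (stab d.-1 (HP P))|)) (pow 2 d.-1)).
Proof.
move=> sP [d0 _] hH; have hS := submon_HP P.
have k0 : 0 < #|img d.-1.+1 (stab d.-1 (HP P))| by apply/card_img_gt0/submon_stab.
apply: (@liminf_growth _ _ (log2 (INR #|img d.-1 (HP P)|))) => j.
rewrite (cardH_GP _ hH) card_Autd INR_expn log2_pow; last by simpl; lra.
rewrite log2_2 Rmult_1_r INR_pow2_pred; congr (Rdiv _ _).
rewrite card_img_growth //.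
- rewrite -multE mult_INR INR_expn log2_mul ?log2_pow ?INR_pow2_pred //; try exact: INR_pos.
  + exact/INR_pos/card_img_gt0.
  + exact/pow_lt/INR_pos.
- exact: HP_sh.
- by move=> n f g hn; apply: HP_node; rewrite -(prednK d0).
Qed.

(** The dimension is $(2^{d-1}-2)/2^{d-1}$; uniqueness of the lower limit lets the kernel order be
    read off from [Hdim_GP]. *)
Lemma Hdim_card d (P : {group {perm W d}}) H : P \subset Autd d -> essential d P ->
  (forall g, H g <-> GP d P g) -> 1 < d ->
  Hdim_is H (Rminus 1 (Rdiv 2 (pow 2 (d - 1)))) <->
  #|img d.-1.+1 (stab d.-1 (HP P))| = 2 ^ (2 ^ d.-1 - 2).
Proof.
move=> sP eP hH d1; have hD := Hdim_GP sP eP hH; rewrite subn1.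
have hM : Rlt 0 (pow 2 d.-1) by apply: pow_lt; lra.
have L : log2 (INR (2 ^ (2 ^ d.-1 - 2))) = Rminus (pow 2 d.-1) 2.
  rewrite INR_expn log2_pow ?log2_2; last by simpl; lra.
  rewrite -minusE minus_INR ?INR_expn; first by rewrite INR_2; simpl; ring.
  (* By [1 < d] the subtraction [2 ^ d.-1 - 2] is not truncated. *)
  by apply/leP; rewrite -{1}(expn1 2) leq_exp2l //; case: d d1 {P H sP eP hH hD hM} => [|[]].
have Q : Rminus 1 (Rdiv 2 (pow 2 d.-1)) = Rdiv (Rminus (pow 2 d.-1) 2) (pow 2 d.-1).
  by field; lra.
rewrite Q; split=> [h|e]; last by rewrite -L -e.
apply: INR_eq; apply: log2_inj.
- exact/INR_pos/card_img_gt0/submon_stab/submon_HP.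
- by apply: INR_pos; rewrite expn_gt0.
rewrite L; apply: (Rmult_eq_reg_r (/ pow 2 d.-1)); first exact: liminf_uniq hD h.
by apply: Rinv_neq_0_compat; lra.
Qed.

(** * The explicit family *)

(** The homomorphism $s_k$, summed through the two sections to suit inductions on $k$. *)
Fixpoint parity k (f : lab) : bool :=
  if k is k'.+1 then parity k' (sh false f) (+) parity k' (sh true f) else f [::].

Lemma eq_parity k f g : (forall w, size w = k -> f w = g w) -> parity k f = parity k g.
Proof.
elim: k f g => [|k IH] f g h /=; first exact: h.
by congr (_ (+) _); apply: IH => w hw; apply: h; rewrite /= hw.
Qed.

Lemma parity_agree n k f g : agree n f g -> k < n -> parity k f = parity k g.
Proof. by move=> h hk; apply: eq_parity => w hw; apply: h; rewrite hw. Qed.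

Lemma parity_xor k f g : parity k (fun w => f w (+) g w) = parity k f (+) parity k g.
Proof.
elim: k f g => [|k IH] f g //=.
by rewrite ![parity k (sh _ (fun _ => _))]IH addbACA.
Qed.

Lemma parity_lab1 k : parity k lab1 = false.
Proof. by elim: k => //= k; rewrite -![sh _ lab1]/lab1 => ->. Qed.

(** A swap at the root of [f] only exchanges the two summands for [g]. *)
Lemma parity_lmul k f g : parity k (lmul f g) = parity k f (+) parity k g.
Proof.
elim: k f g => [|k IH] f g //=.
have E x : parity k (sh x (lmul f g)) = parity k (sh x f) (+) parity k (sh (x (+) f [::]) g).
  exact: IH.
by rewrite !E addbACA; congr (_ (+) _); case: (f [::]); rewrite //= addbC.
Qed.

Definition delta (u : seq bool) : lab := fun w => w == u.

Lemma parity_sh_delta k x y u :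
  parity k (sh x (delta (y :: u))) = (x == y) && parity k (delta u).
Proof.
case: eqP => [->|hxy] /=.
  by apply: eq_parity => w _; rewrite /sh /delta eqseq_cons eqxx.
by rewrite -(parity_lab1 k); apply: eq_parity => w _; rewrite /sh /delta eqseq_cons; case: eqP.
Qed.

Lemma parity_delta k u : parity k (delta u) = (size u == k).
Proof.
elim: k u => [|k IH] [|y u] //=.
  by rewrite (_ : sh false _ = lab1) // (_ : sh true _ = lab1) // parity_lab1.
by rewrite !parity_sh_delta IH eqSS; case: y; rewrite /= ?addbF.
Qed.

Lemma act_delta u w : size w <= size u -> act (delta u) w = w.
Proof.
by apply: act_small => v hv; apply/eqP=> e; rewrite e ltnn in hv.
Qed.

(** Right multiplication by a single swap toggles one label of [f], which allows clearing labels one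
    at a time. *)
Lemma lmul_delta f u w : lmul f (delta (act f u)) w = f w (+) (w == u).
Proof. by rewrite /lmul /delta (inj_eq (@act_inj f)). Qed.

Section Family.
Variables (m : nat) (a b : nat -> bool) (e : bool).

(* The pair [(twist false, twist true)] is a crossed homomorphism to [F_2^2],
   on which an automorphism acts by exchanging the coordinates when it swaps
   the first letter; see [twist_lmul]. *)
Definition twist (x : bool) (f : lab) : bool :=
  parity m (sh x f) (+)
  (\big[addb/false]_(k < m) ((a k && parity k (sh x f)) (+) (b k && parity k (sh (~~ x) f)))
   (+) (e && f [::])).

Lemma twist_lmul x f g : twist x (lmul f g) = twist x f (+) twist (x (+) f [::]) g.
Proof.
have E k y : parity k (sh y (lmul f g)) = parity k (sh y f) (+) parity k (sh (y (+) f [::]) g).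
  exact: (parity_lmul k (sh y f) (sh (y (+) f [::]) g)).
have E0 : lmul f g [::] = f [::] (+) g [::] by [].
rewrite /twist E E0 andb_addr [RHS]addbACA; congr (_ (+) _).
rewrite [RHS]addbACA; congr (_ (+) _); rewrite -big_split; apply: eq_bigr => k _ /=.
by rewrite !E !andb_addr addbACA -addNb.
Qed.

Lemma twist_low x f g : agree m.+1 f g ->
  twist x f (+) twist x g = parity m (sh x f) (+) parity m (sh x g).
Proof.
move=> h; rewrite /twist addbACA -[RHS]addbF (h [::]) //; congr (_ (+) _).
rewrite (eq_bigr (fun k : 'I_m => (a k && parity k (sh x g)) (+) (b k && parity k (sh (~~ x) g)))) ?addbb //.
by move=> k _; rewrite !(@parity_agree m k (sh _ f) _ (agree_sh _ h)).
Qed.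

(** A lift of a single swap isolates one coefficient: [a] on the side containing the swap, [b] on
    the other. *)
Lemma twist_delta x y u f : size u < m -> agree m.+1 f (delta (y :: u)) ->
  twist x f = parity m (sh x f) (+) (if x == y then a (size u) else b (size u)).
Proof.
move=> hu h; rewrite /twist (h [::]) //= andbF addbF; congr (_ (+) _).
have E k z : k < m -> parity k (sh z f) = (z == y) && (size u == k).
  by move=> hk; rewrite (parity_agree (agree_sh z h) hk) parity_sh_delta parity_delta.
rewrite (bigD1 (Ordinal hu)) //= big1 => [|k hk].
  by rewrite !E // eqxx; case: (x) (y) => [] [] /=; rewrite ?andbT ?andbF ?addbF.
rewrite !E // (negbTE (_ : size u != k)) ?andbF //.
by apply: contraNneq hk => hk; apply/eqP/val_inj.
Qed.

Lemma twist_delta_nil x f : agree m.+1 f (delta [::]) ->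
  twist x f = parity m (sh x f) (+) e.
Proof.
move=> h; rewrite /twist (h [::]) //= andbT big1 ?addFb // => k _.
by rewrite !(parity_agree (agree_sh _ h)) // -![sh _ (delta [::])]/lab1 parity_lab1 !andbF.
Qed.

Definition twisted (f : lab) := forall x, twist x f = false.

Lemma twist_lab1 x : twist x lab1 = false.
Proof.
rewrite /twist -![sh _ lab1]/lab1 parity_lab1 andbF /= addbF big1 // => k _.
by rewrite !parity_lab1 !andbF.
Qed.

Lemma twist_agree x f g : agree m.+2 f g -> twist x f = twist x g.
Proof.
move=> h; apply: (@addIb (twist x g)).
by rewrite twist_low ?(parity_agree (agree_sh x h)) ?addbb //; apply: agreeW h.
Qed.

Lemma submon_twisted : submon twisted.
Proof.
split=> [x|f g hf hg x]; first exact: twist_lab1.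
by rewrite twist_lmul hf hg.
Qed.

Definition PG : {group {perm W m.+2}} := Group (img_group_set m.+2 submon_twisted).

Lemma mem_PG f : mk m.+2 f \in PG <-> twisted f.
Proof.
split=> [/imgP[g hg /mk_eqP h] x|h]; last exact: mem_img.
by rewrite -(twist_agree x h).
Qed.

Lemma sub_PG : PG \subset Autd m.+2. Proof. exact: img_Autd. Qed.

(** Toggling the label at $x0^m$, on level $m+1$, changes [twist x] and not the other twist, so both
    can be repaired independently. *)
Lemma twisted_extend f : exists2 g, twisted g & agree m.+1 f g.
Proof.
pose g : lab := fun w => f w (+) ((behead w == nseq m false) && (size w == m.+1) && twist (head false w) f).
have fg : agree m.+1 f g.
  by move=> w hw; rewrite /g (ltn_eqF hw) andbF addbF.
exists g => // x; apply: (@addIb (twist x f)); rewrite addbC twist_low // addFb.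
have -> : parity m (sh x g) = parity m (fun w => sh x f w (+) (delta (nseq m false) w && twist x f)).
  by apply: eq_parity => w hw; rewrite /sh /g /= hw eqxx andbT.
rewrite parity_xor addKb; case: (twist x f).
  have pd : parity m (delta (nseq m false)) by rewrite parity_delta size_nseq.
  by rewrite -[RHS]pd; apply: eq_parity => w _; rewrite andbT.
by rewrite -[RHS](parity_lab1 m); apply: eq_parity => w _; rewrite andbF.
Qed.

(** The lower terms of [twist] vanish on the kernel, which is therefore the same for all
    coefficients. *)
Lemma stab_twisted f :
  stab m.+1 twisted f <-> stab m.+1 (fun f => forall x, parity m (sh x f) = false) f.
Proof.
have E x : agree m.+1 f lab1 -> twist x f = parity m (sh x f).
  move=> h; have := twist_low x h.
  by rewrite twist_lab1 -[sh _ lab1]/lab1 parity_lab1 !addbF.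
by split=> -[h e1]; split=> // x; have := h x; rewrite E.
Qed.

(** Multiplication by the swap at $0^m$ exchanges the even and the odd elements of the kernel. *)
Lemma card_stab_parity :
  2 * #|img m.+1 (stab m (fun f => parity m f = false))| = 2 ^ 2 ^ m.
Proof.
set Z := img _ _; pose t := mk m.+1 (delta (nseq m false)).
have dt : agree m (delta (nseq m false)) lab1.
  by move=> w hw; apply/eqP=> ew; rewrite ew size_nseq ltnn in hw.
have dp : parity m (delta (nseq m false)) by rewrite parity_delta size_nseq.
rewrite -card_stab_all -(cardsID Z (img _ (stab m all_lab))) mul2n -addnn; congr (_ + _).
  congr #|pred_of_set _|; apply/esym/setIidPr; apply: img_sub => f [_ h]; by split.
rewrite -(card_rcoset Z t); apply: eq_card => p; apply/rcosetP/setDP.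
- case=> _ /imgP[f [hf ef] <-] ->; rewrite -mkM; split.
    apply: mem_img; split=> // w hw.
    by rewrite /lmul ef // dt ?size_act.
  apply/imgP=> -[g [hg _] /mk_eqP/parity_agree/(_ (ltnSn m))].
  by rewrite hg parity_lmul hf dp.
- case=> /imgP[f [_ ef] <-] hf.
  have pf : parity m f.
    by apply: contraNT hf => /negbTE hf; apply: mem_img.
  exists (mk m.+1 (lmul f (delta (nseq m false)))).
    apply: mem_img; split; first by rewrite parity_lmul pf dp.
    by move=> w hw; rewrite /lmul ef // dt ?size_act.
  rewrite -mkM; apply/mk_eqP=> w hw.
  have aw : act f w = w by apply: act_small ef _.
  by rewrite /lmul !act_lmul aw act_delta ?size_nseq // addbK.
Qed.

Lemma card_stab_twisted : #|img m.+2 (stab m.+1 twisted)| = 2 ^ (2 ^ m.+1 - 2).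
Proof.
have -> : img m.+2 (stab m.+1 twisted) =
    img m.+2 (stab m.+1 (fun f => forall x, parity m (sh x f) = false)).
  by apply/eqP; rewrite eqEsubset; apply/andP; split; apply: img_sub => f /stab_twisted.
rewrite (@card_stab_eq _ _ (fun f => parity m f = false)) //; last first.
  by move=> f g [hf _] [hg _] [|]; [exact: hg | exact: hf].
(* Multiplying by 4 supplies the factor 2 of [card_stab_parity] for each of the two sections. *)
have h := card_stab_parity; apply/eqP; rewrite -(eqn_pmul2l (_ : 0 < 2 ^ 2)) // -expnMn h.
have h2 : 2 <= 2 ^ m.+1 by rewrite -{1}(expn1 2) leq_exp2l.
by rewrite -expnM -expnD subnKC // expnSr.
Qed.

Lemma essential_PG : essential m.+2 PG.
Proof.
apply/(essentialP sub_PG); split=> // f _ x.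
have [g hg h] := twisted_extend (sh x f).
by exists g; [exact/mem_PG | exact: agree_sym].
Qed.

Lemma PG_HP f : exists2 g, HP PG g & agree m.+1 f g.
Proof.
have [g /mem_PG hg h] := twisted_extend f.
rewrite -(img_HP sub_PG essential_PG) in hg; case/imgP: hg => k hk /mk_eqP e1.
by exists k => //; apply: agree_trans h _; apply/agree_sym/(agreeW _ e1).
Qed.

(** All patterns of size $m+1$ occur ([PG_HP]), so a pattern group of smaller size would contain
    every pattern and define all of $G$; but a single swap on level $m+1$ violates [twisted]. *)
Lemma FC_PG : FC_size m.+2 (GP m.+2 PG).
Proof.
split; first by exists PG; split; [exact: sub_PG | split=> //; exact: essential_PG].
move=> d' hd' [Q [sQ [eQ hQ]]].
have full f : mk d' f \in Q.
  have [g hg h] := PG_HP f.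
  have /hQ/GP_act/(_ [::]) : GP m.+2 PG (act g) by apply/GP_act.
  by rewrite (_ : mk d' f = mk d' (shw [::] g)) //; apply/mk_eqP/(agreeW _ h).
have : HP PG (delta (false :: nseq m false)).
  by apply/GP_act/hQ/GP_act => w; exact: full.
move/(_ [::])/mem_PG/(_ false).
have low : agree m.+1 (delta (false :: nseq m false)) lab1.
  by move=> w hw; apply/eqP=> ew; rewrite ew /= size_nseq ltnn in hw.
have := twist_low false low; rewrite twist_lab1 addbF -[sh _ lab1]/lab1 parity_lab1 addbF => ->.
by rewrite [parity _ _](parity_delta m (nseq m false)) size_nseq eqxx.
Qed.

End Family.

(** * Projection to the previous level *)

Section FullProjection.
Variables (m : nat) (P : {group {perm W m.+2}}).
Hypotheses (sP : P \subset Autd m.+2) (eP : essential m.+2 P)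
  (minP : ~ defined_by m.+1 (GP m.+2 P))
  (cP : #|img m.+2 (stab m.+1 (HP P))| = 2 ^ (2 ^ m.+1 - 2)).

Let kc n := #|img n.+1 (stab n (HP P))|.

Lemma kc_dvd n : kc n %| 2 ^ 2 ^ n.
Proof.
rewrite -card_stab_all.
have h1 := img_group_set n.+1 (submon_stab n (submon_HP P)).
have h2 := img_group_set n.+1 (submon_stab n submon_all).
have s : Group h1 \subset Group h2 by apply: img_sub => f [_ h].
exact: cardSg s.
Qed.

(** Kernel orders at most square from one level to the next, so a full kernel forces full kernels at
    all earlier levels. *)
Lemma kc_full n : kc n = 2 ^ 2 ^ n -> #|img n.+1 (HP P)| = #|Autd n.+1|.
Proof.
have E k : #|img k.+1 (HP P)| = #|img k (HP P)| * kc k by apply/card_img_succ/submon_HP.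
have E' k : #|Autd k.+1| = #|Autd k| * 2 ^ 2 ^ k.
  by rewrite -!img_all card_img_succ // card_stab_all.
elim: n => [|n IH] h; rewrite E E' h; congr (_ * _).
  by apply/eqP; rewrite eqn_leq subset_leq_card ?img_Autd // card_Autd card_img_gt0 //;
    exact: submon_HP.
apply: IH; apply/eqP; rewrite eqn_leq dvdn_leq ?kc_dvd ?expn_gt0 //=.
rewrite -leq_sqr -expnM -expnSr -h; apply: card_stab_le; exact: HP_sh.
Qed.

(* Otherwise [kc m.+1 = kc m ^ 2], and the group defined by the patterns of size
   [m.+1] of [G_P] has no more restrictions to level [m.+2] than [G_P] itself. *)
Lemma kc_full_level : kc m = 2 ^ 2 ^ m.
Proof.
have /(dvdn_pfactor _ _ (isT : prime 2))[t ht et] := kc_dvd m.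
case: (ltnP t (2 ^ m)) => [hlt|hge]; last first.
  by rewrite et; congr (_ ^ _); apply/eqP; rewrite eqn_leq ht hge.
case: minP.
(* From [t < 2 ^ m] follows [2 * t <= 2 ^ m.+1 - 2], so [cP] gives the converse of
   [card_stab_le]. *)
have cE : kc m.+1 = kc m ^ 2.
  apply/eqP; rewrite eqn_leq card_stab_le /=; last exact: HP_sh.
  rewrite {2}/kc cP et -expnM leq_exp2l // leq_subRL ?expnS; last first.
    by rewrite -{1}(muln1 2) leq_mul2l expn_gt0.
  by rewrite (mulnC t) -{1}(muln1 2) -mulnDr leq_mul2l.
pose Q := Group (img_group_set m.+1 (submon_HP P)).
have sQ : Q \subset Autd m.+1 by exact: img_Autd.
have eQ : essential m.+1 Q.
  apply/(essentialP sQ); split=> // f /imgP[g hg /mk_eqP h] x.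
  exists (sh x g); first by apply/mem_img/HP_sh.
  by apply: agree_sh => w hw; apply: h.
have PQ f : HP P f -> HP Q f by move=> h w; apply/mem_img/HP_shw.
have E : img m.+2 (HP P) = img m.+2 (HP Q).
  have c : #|img m.+2 (HP Q)| = #|img m.+2 (HP P)|.
    have e1 : img m.+1 (HP Q) = img m.+1 (HP P) := img_HP sQ eQ.
    rewrite !(card_img_succ m.+1 (submon_HP _)) e1 -/(kc m.+1) cE.
    rewrite (@card_stab_eq m _ (HP Q)); [|exact: HP_sh|move=> f g; exact: HP_node].
    by rewrite img_stab e1 -img_stab.
  by apply/eqP; rewrite eqEcard (img_sub _ PQ); apply: eq_leq c.
exists Q; split=> //; split=> // g; split=> /GP_HP[f hf e1].
  by apply/GP_HP; exists f; first exact: PQ.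
apply/GP_HP; exists f => // w; rewrite -(img_HP sP eP) E.
by apply/mem_img/HP_shw.
Qed.

Lemma full_projection : img m.+1 (HP P) = Autd m.+1.
Proof. by apply/eqP; rewrite eqEcard img_Autd (kc_full kc_full_level) /=. Qed.

End FullProjection.

(** A maximal subgroup of $G$ above $P$ has index 2 in the 2-group $G$, and $P$ has index 2 in it;
    index 2 subgroups are normal with abelian quotient. *)
Lemma index4_commutators (gT : finGroupType) (G P : {group gT}) :
  (2.-group G -> P \subset G -> #|G : P| = 4 ->
  exists M : {group gT}, [/\ P \subset M,
    forall x y, x \in G -> y \in G -> [~ x, y] \in M &
    forall x y, x \in M -> y \in M -> [~ x, y] \in P])%g.
Proof.
move=> pG sPG i4.
have comm2 (H K : {group gT}) : (K \subset H -> #|H : K| = 2 ->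
    forall x y, x \in H -> y \in H -> [~ x, y] \in K)%g.
  move=> sKH i2 x y hx hy; have nK := index2_normal sKH i2.
  have ab : (abelian (H / K))%g.
    by apply/cyclic_abelian/prime_cyclic; rewrite card_quotient ?normal_norm ?i2.
  by apply: (subsetP (der1_min (normal_norm nK) ab)); apply: mem_commg.
have [e|[M maxM sPM]] := maximal_exists sPG.
  by move: i4; rewrite e indexgg.
have sMG : M \subset G by case/maxgroupP: maxM => /andP[].
have iM := p_maximal_index pG maxM.
have iP : (#|M : P| = 2)%g.
  have := Lagrange_index sMG sPM; rewrite iM i4 => e.
  by apply/eqP; rewrite -(@eqn_pmul2l 2) // e.
by exists M; split=> //; apply: comm2.
Qed.

(** * Classification *)

(** Labels depend only on the length of the word: this adds [u] and [v] letterwise, and the default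
    [false] leaves the letters past both words alone. *)
Definition flip (u v : seq bool) : lab :=
  fun w => nth false u (size w) (+) nth false v (size w).

Lemma act_flip u v : size u = size v -> act (flip u v) u = v.
Proof.
elim: u v => [|x u IH] [|y v] //= [h].
rewrite /flip /= addKb; congr (_ :: _); exact: IH h.
Qed.

Lemma flip_long u v w : size u = size v -> size u <= size w -> flip u v w = false.
Proof. by move=> e h; rewrite /flip !nth_default // -e. Qed.

(** Conjugation by [h] carries the swap at [u] to [act h u]. Only labels of [h] below the level of
    [u] could be displaced by the swap, and these vanish. *)
Lemma delta_lmul n h u : (forall w, size u < size w -> size w < n -> h w = false) ->
  agree n (lmul (delta u) h) (lmul h (delta (act h u))).
Proof.
move=> hh w hw; rewrite lmul_delta /lmul addbC; congr (_ (+) _).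
case: (leqP (size w) (size u)) => hs; first by rewrite act_delta.
by rewrite !hh ?size_act.
Qed.

Lemma delta_sqr u w : lmul (delta u) (delta u) w = false.
Proof.
rewrite /lmul /delta; case: eqP => [->|h]; first by rewrite act_delta ?eqxx.
by apply/eqP => e; apply: h; apply: (@act_inj (delta u)); rewrite e act_delta.
Qed.

Lemma delta_low n u : size u = n -> agree n (delta u) lab1.
Proof. by move=> h w hw; apply/eqP=> e; rewrite e h ltnn in hw. Qed.

Lemma lmul_top n f g : agree n f lab1 -> agree n.+1 (lmul f g) (fun w => f w (+) g w).
Proof. by move=> h w hw; rewrite /lmul (act_small h). Qed.

Lemma mk_conj_delta n u h : size u = n ->
  (mk n.+1 (delta u) ^ mk n.+1 h = mk n.+1 (delta (act h u)))%g.
Proof.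
move=> hu; rewrite conjgE -mkM (_ : mk n.+1 (lmul (delta u) h) = mk n.+1 (lmul h (delta (act h u)))).
  by rewrite mkM mulKg.
by apply/mk_eqP/delta_lmul => w; rewrite hu => h1 h2; rewrite ltnNge h1 in h2.
Qed.

Lemma mk_delta_inv n u : (mk n (delta u))^-1%g = mk n (delta u).
Proof.
apply/eqP; rewrite eq_invg_mul -mkM -mk1; apply/eqP/mk_eqP=> w _.
exact: delta_sqr.
Qed.

Section Classification.
Variables (m : nat) (P : {group {perm W m.+2}}).
Let inP f := mk m.+2 f \in P.
Hypotheses (sP : P \subset Autd m.+2)
  (fullP : forall f, exists2 g, inP g & agree m.+1 f g)
  (topP : #|img m.+2 (stab m.+1 inP)| = 2 ^ (2 ^ m.+1 - 2)).

Lemma submon_inP : submon inP.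
Proof.
split=> [|f g hf hg]; rewrite /inP; first by rewrite mk1 group1.
by rewrite mkM groupM.
Qed.

Lemma img_inP : img m.+2 inP = P.
Proof.
apply/setP=> p; apply/imgP/idP => [[f hf <-] //|hp].
by have /AutdP[f e] := subsetP sP _ hp; exists f; rewrite // /inP e.
Qed.

Lemma card_inP : #|P| = #|Autd m.+1| * 2 ^ (2 ^ m.+1 - 2).
Proof.
rewrite -topP -[in LHS]img_inP (card_img_succ _ submon_inP); congr (_ * _).
rewrite -img_all; apply: eq_card => p; apply/imgP/imgP => -[f hf <-]; first by exists f.
by have [g hg h] := fullP f; exists g => //; apply/mk_eqP/agree_sym.
Qed.

Lemma index_P : (#|Autd m.+2 : P| = 4)%g.
Proof.
have h2 : 2 <= 2 ^ m.+1 by rewrite -{1}(expn1 2) leq_exp2l.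
have gA : group_set (Autd m.+2) by rewrite -img_all; apply: img_group_set.
have cA : #|Group gA| = 2 ^ (2 ^ m.+2 - 1) := card_Autd m.+2.
apply: etrans (esym (@divgS _ (Group gA) P sP)) _.
rewrite cA card_inP card_Autd -expnD.
rewrite (_ : 2 ^ m.+2 - 1 = 2 + (2 ^ m.+1 - 1 + (2 ^ m.+1 - 2))); last first.
  rewrite (addnC 2) -addnA subnK // [2 ^ m.+2]expnS mul2n -addnn addnBAC //.
  exact: ltnW.
by rewrite expnD mulnK ?expn_gt0.
Qed.

(* The commutator of [delta (y :: u) + delta x0], itself a commutator, with an
   element of [P] that moves [y :: u] to [y :: v] and fixes [x0]. *)
Lemma pair_inP y u v : size u = m -> size v = m ->
  inP (fun w => delta (y :: u) w (+) delta (y :: v) w).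
Proof.
move=> hu hv; pose x0 := ~~ y :: u.
have gA : group_set (Autd m.+2) by rewrite -img_all; apply: img_group_set.
have pA : (2.-group (Group gA))%g by rewrite /pgroup (card_Autd m.+2 : #|Group gA| = _) pnatX.
have [M [sPM hM hP]] := index4_commutators pA sP index_P.
have inA f : mk m.+2 f \in Group gA by apply/AutdP; exists f.
(* [g] acts as [flip u v] on the subtree at [y] and trivially on the other; [g'] is a lift of it in
   [P]. *)
pose g : lab := fun w => if w is z :: w' then (z == y) && flip u v w' else false.
have gu : act g (y :: u) = y :: v.
  rewrite /= addbF; congr (_ :: _); rewrite -[RHS](act_flip (etrans hu (esym hv))).
  by apply: (@act_agree m); rewrite ?hu // => w _; rewrite /sh /= eqxx.
have gx : act g x0 = x0.
  rewrite /= addbF; congr (_ :: _); apply: (@act_small m); rewrite ?hu // => w _.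
  by rewrite /sh /=; case: (y).
have [g' hg' eg] := fullP g.
have su z : size (z :: u) = m.+1 by rewrite /= hu.
have hm : (mk m.+2 (delta (y :: u)) * mk m.+2 (delta x0) \in M)%g.
  have := hM _ _ (inA (delta (y :: u))) (inA (flip (y :: u) x0)).
  by rewrite commgEl (mk_conj_delta _ (su _)) mk_delta_inv act_flip.
have := hP _ _ hm (subsetP sPM _ hg').
rewrite commgEl conjMg !(mk_conj_delta _ (su _)) invMg !mk_delta_inv.
rewrite -!(act_agree eg) ?su // gu gx -!mkM /inP.
rewrite (_ : mk _ _ = mk m.+2 (fun w => delta (y :: u) w (+) delta (y :: v) w)) //.
apply/mk_eqP=> w hw.
have low a b : size a = m -> agree m.+1 (delta (b :: a)) lab1 by move=> h; apply: delta_low; rewrite /= h.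
have top a b f : size a = m -> lmul (delta (b :: a)) f w = delta (b :: a) w (+) f w.
  by move=> h; rewrite (lmul_top _ (low a b h)).
rewrite lmulA !top // addbC -!addbA addbb addbF //.
Qed.

(* By the cardinality hypothesis this inclusion is an equality ([inP_top]). *)
Lemma top_inP f : agree m.+1 f lab1 -> (forall x, parity m (sh x f) = false) -> inP f.
Proof.
pose z := nseq m false; have sz : size z = m by rewrite size_nseq.
(* Clear the swaps in pairs until only the words [y :: z] can carry one. *)
have base (h : lab) : (forall y u, size u = m -> h (y :: u) -> u = z) ->
    (forall x, parity m (sh x h) = false) -> agree m.+1 h lab1 -> inP h.
  move=> hz hp h1; rewrite /inP (_ : mk _ _ = 1%g) ?group1 //.
  rewrite -mk1; apply/mk_eqP=> w; rewrite ltnS leq_eqVlt => /orP[/eqP|]; last exact: h1.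
  case: w => [|y u] // [hu]; apply: negbTE; apply/negP=> hyu.
  have := hp y; rewrite (@eq_parity m _ (delta z)) ?parity_delta ?sz ?eqxx //.
  move=> w hw; rewrite /sh /delta; case: eqP => [->|hn].
    by rewrite -(hz _ _ hu hyu).
  by apply: negbTE; apply/negP=> /(hz _ _ hw).
(* [L] lists the words whose swap may still have to be cleared. *)
have main (L : seq (seq bool)) : forall h : lab,
    (forall y u, size u = m -> h (y :: u) -> u = z \/ y :: u \in L) ->
    (forall x, parity m (sh x h) = false) -> agree m.+1 h lab1 -> inP h.
  elim: L => [|v L IH] h hL hp h1; first by apply: base => // y u hu /(hL _ _ hu)[].
  have skip : (forall y u, y :: u = v -> size u = m -> h (y :: u) -> u = z) -> inP h.
    move=> hv; apply: IH => // y u hu hyu.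
    have [->|] := hL y u hu hyu; first by left.
    by rewrite inE => /orP[/eqP e|]; [left; apply: hv hyu | right].
  case: v hL skip => [|y u] hL skip; first by apply: skip.
  case: (eqVneq (size u) m) => [hu|hu]; last first.
    by apply: skip => y' u' [_ ->] /eqP; rewrite (negbTE hu).
  case hyu: (h (y :: u)); last by apply: skip => y' u' [-> ->] _; rewrite hyu.
  case: (eqVneq u z) => [uz|uz]; first by apply: skip => y' u' [_ ->].
  have hg := pair_inP y hu sz.
  set g := (fun w => _) in hg.
  have g1 : agree m.+1 g lab1.
    by move=> w hw; rewrite /g !(delta_low _ hw) //= ?hu ?sz.
  (* Adding the pair cancels the swap at [y :: u] and toggles the label at [y :: z], so the tail of
     the list suffices. *)
  have : mk m.+2 (fun w => h w (+) g w) \in P.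
    apply: IH.
    - move=> y' u' hu'; rewrite /g /delta !eqseq_cons.
      case: (eqVneq u' z) => [->|nz]; first by left.
      rewrite andbF addbF; case: eqP => [->|ny] /=; last first.
        rewrite addbF => /(hL _ _ hu')[|]; first by left.
        by rewrite inE eqseq_cons => /orP[/andP[/eqP/ny]|]; [|right].
      case: eqP => [->|nu] /=; first by rewrite hyu.
      rewrite addbF => /(hL _ _ hu')[|]; first by left.
      by rewrite inE eqseq_cons => /orP[/andP[_ /eqP/nu]|]; [|right].
    - move=> x; have -> : parity m (sh x (fun w => h w (+) g w)) = parity m (sh x h) (+) parity m (sh x g).
        exact: (parity_xor m (sh x h) (sh x g)).
      rewrite hp addFb.
      have -> : parity m (sh x g) = parity m (sh x (delta (y :: u))) (+) parity m (sh x (delta (y :: z))).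
        exact: (parity_xor m (sh x (delta (y :: u))) (sh x (delta (y :: z)))).
      by rewrite !parity_sh_delta !parity_delta hu sz addbb.
    - by move=> w hw; rewrite h1 // g1.
  have <- : mk m.+2 (lmul h g) = mk m.+2 (fun w => h w (+) g w) by exact/mk_eqP/lmul_top.
  by rewrite mkM groupMr.
move=> f1 fp; apply: (main (words m.+1)) => // y u hu _; right.
by rewrite mem_words /= hu.
Qed.

Lemma inP_top f : inP f -> agree m.+1 f lab1 -> forall x, parity m (sh x f) = false.
Proof.
move=> hf h1; pose C f := forall x, parity m (sh x f) = false.
have hs : img m.+2 (stab m.+1 C) \subset img m.+2 (stab m.+1 inP).
  by apply: img_sub => g [hg g1]; split=> //; apply: top_inP.
have cC : #|img m.+2 (stab m.+1 C)| = 2 ^ (2 ^ m.+1 - 2).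
  (* Any coefficients give the same kernel; zero is chosen. *)
  rewrite -(card_stab_twisted m xpred0 xpred0 false); apply/eqP; rewrite eqn_leq.
  by apply/andP; split; apply/subset_leq_card/img_sub => g /stab_twisted.
have /eqP E : img m.+2 (stab m.+1 C) == img m.+2 (stab m.+1 inP).
  by rewrite eqEcard hs; apply: eq_leq; rewrite cC.
have : mk m.+2 f \in img m.+2 (stab m.+1 inP) by apply: mem_img.
rewrite -E => /imgP[g [hg _] /mk_eqP e] x.
by rewrite -(parity_agree (agree_sh x e)).
Qed.

(** Multiplying both by the inverse [k] of [f] gives elements of [P] that fix level $m+1$, where
    [inP_top] applies. *)
Lemma parity_inP f g x : inP f -> inP g -> agree m.+1 f g -> parity m (sh x f) = parity m (sh x g).
Proof.
move=> hf hg h.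
have [k hk] : exists k, mk m.+2 k = (mk m.+2 f)^-1%g.
  by apply/AutdP/(subsetP sP); rewrite groupV.
have ek : agree m.+2 (lmul f k) lab1 by apply/mk_eqP; rewrite mkM hk mulgV mk1.
have kP : inP k by rewrite /inP hk groupV.
have E l y : parity m (sh y (lmul l k)) = parity m (sh y l) (+) parity m (sh (y (+) l [::]) k).
  exact: (parity_lmul m (sh y l) (sh (y (+) l [::]) k)).
have E1 l : inP l -> agree m.+1 f l -> parity m (sh x (lmul l k)) = false.
  move=> hl fl; apply: inP_top; first by rewrite /inP mkM groupM.
  apply: agree_trans (agreeW _ ek) => //; apply: agree_lmul => //; exact: agree_sym.
apply: (@addIb (parity m (sh (x (+) f [::]) k))).
by rewrite -E (h [::]) // -E !E1.
Qed.

(** The coefficients are the top parities of elements of [P] lifting single swaps: at the root for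
    [e], at $00^k$ for [a k] and [b k]. *)
Section Coefficients.
Variables (a b : nat -> bool) (e : bool).
Hypotheses
  (e_def : exists2 q, inP q & agree m.+1 (delta [::]) q /\ parity m (sh false q) = e)
  (ab_def : forall k, k < m -> exists q, [/\ inP q,
         agree m.+1 (delta (false :: nseq k false)) q,
         parity m (sh false q) = a k & parity m (sh true q) = b k]).

(* Conjugation in [P] reduces [delta u] to the words used to define [a], [b], [e]. *)
Lemma twist_inP_delta u f x : size u <= m -> inP f -> agree m.+1 f (delta u) ->
  twist m a b e x f = false.
Proof.
case: u => [|y u] hu hf h.
  rewrite twist_delta_nil //; have [q hq [h1 <-]] := e_def.
  rewrite -(@parity_inP f q false) //; last exact: agree_trans h h1.
  case: x; rewrite ?addbb //.
  (* The square of [f] lies in the kernel, and its section parity is the sum of the two section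
     parities of [f]; hence these agree. *)
  have ff : agree m.+1 (lmul f f) lab1.
    apply: agree_trans (agree_lmul h h) _ => w _; exact: delta_sqr.
  have /inP_top/(_ ff false) : inP (lmul f f) by rewrite /inP mkM groupM.
  rewrite [parity _ _](parity_lmul m (sh false f) (sh (false (+) f [::]) f)) (h [::]) //=.
  by rewrite addbC.
rewrite (twist_delta _ _ _ _ hu h); have [q [hq h1 ha hb]] := ab_def hu.
set u0 := false :: nseq (size u) false in h1.
have s0 : size u0 = size (y :: u) by rewrite /= size_nseq.
(* [k] carries [u0] to [y :: u], so the products $qk$ and $kf$ agree up to level $m$ and
   [parity_inP] equates their top parities. *)
have [k hk h2] := fullP (flip u0 (y :: u)).
have E : agree m.+1 (lmul q k) (lmul k f).
  apply: (@agree_trans _ _ (lmul (delta u0) (flip u0 (y :: u)))).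
    by apply: agree_lmul; apply: agree_sym.
  apply: (@agree_trans _ _ (lmul (flip u0 (y :: u)) (delta (y :: u)))).
    have := @delta_lmul m.+1 (flip u0 (y :: u)) u0; rewrite act_flip //; apply=> w hw _.
    by apply: flip_long => //; apply: ltnW.
  by apply: agree_lmul => //; apply: agree_sym.
have k0 : k [::] = y by rewrite -h2.
have q0 : q [::] = false by rewrite -h1.
have := @parity_inP _ _ (x (+) y) _ _ E.
have -> : parity m (sh (x (+) y) (lmul q k)) = parity m (sh (x (+) y) q) (+) parity m (sh (x (+) y) k).
  by rewrite [LHS](parity_lmul m (sh (x (+) y) q) (sh (x (+) y (+) q [::]) k)) q0 addbF.
have -> : parity m (sh (x (+) y) (lmul k f)) = parity m (sh (x (+) y) k) (+) parity m (sh x f).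
  by rewrite [LHS](parity_lmul m (sh (x (+) y) k) (sh (x (+) y (+) k [::]) f)) k0 addbK.
rewrite /inP !mkM !groupM // => /(_ isT isT); rewrite addbC => /addbI <-.
by case: (x) (y) => [] []; rewrite /= ?ha ?hb addbb.
Qed.

(** Labels up to level $m$ are cleared one by one with lifts in [P] of single swaps, whose twists
    vanish; what remains is in the kernel. *)
Lemma inP_twisted f : inP f -> twisted m a b e f.
Proof.
have main (L : seq (seq bool)) : forall g, inP g -> (forall w, size w <= m -> g w -> w \in L) ->
    twisted m a b e g.
  elim: L => [|u L IH] g hg hL x.
    have g1 : agree m.+1 g lab1 by move=> w hw; apply: negbTE; apply/negP => /(hL _ hw).
    have := twist_low a b e x g1.
    by rewrite twist_lab1 -[sh _ lab1]/lab1 parity_lab1 !addbF inP_top.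
  case: (boolP ((size u <= m) && g u)) => [/andP[hu gu]|hu]; last first.
    apply: IH => // w hw gw; have := hL w hw gw; rewrite inE => /orP[/eqP wu|//].
    by rewrite -wu hw gw in hu.
  have [q hq h] := fullP (delta (act g u)).
  have tq := @twist_inP_delta (act g u) q _ _ hq (agree_sym h).
  have : twist m a b e x (lmul g q) = false.
    apply: IH; first by rewrite /inP mkM groupM.
    move=> w hw; rewrite /lmul -h ?size_act // -[_ (+) _]/(lmul g _ w) lmul_delta.
    case: eqP => [->|wu]; first by rewrite gu.
    by rewrite addbF => /(hL _ hw); rewrite inE => /orP[/eqP/wu|].
  by rewrite twist_lmul tq ?size_act // addbF.
by move=> hf; apply: (main (words m)) => // w hw _; rewrite mem_words.
Qed.

(** After the inclusion, orders are compared: the kernels have equal order and [P] already projects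
    onto [Autd m.+1]. *)
Lemma classified : P :=: PG m a b e.
Proof.
apply/eqP; rewrite eqEcard; apply/andP; split.
  apply/subsetP=> p hp; have /AutdP[f ef] := subsetP sP _ hp; rewrite -{}ef in hp *.
  exact/mem_PG/inP_twisted.
rewrite card_inP -(card_stab_twisted m a b e) -img_all.
apply: (@leq_trans #|img m.+2 (twisted m a b e)|) => //.
rewrite (card_img_succ m.+1 (submon_twisted m a b e)) leq_mul2r; apply/orP; right.
exact/subset_leq_card/img_sub.
Qed.

End Coefficients.
End Classification.

(** * The count *)

Lemma twisted_sub m a b e a' b' e' :
  (forall g, GP m.+2 (PG m a b e) g -> GP m.+2 (PG m a' b' e') g) ->
  forall f, twisted m a b e f -> twisted m a' b' e' f.
Proof.
move=> h f /mem_PG; rewrite -(img_HP (sub_PG m a b e) (essential_PG m a b e)).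
case/imgP=> g /GP_act/h/GP_act/(_ [::])/mem_PG hg /mk_eqP e1 x.
by rewrite -(twist_agree _ _ _ _ e1).
Qed.

(** A lift of a single swap satisfies both systems; its top parity cancels in the comparison and
    leaves the coefficient. *)
Lemma PG_inj m a b e a' b' e' :
  (forall g, GP m.+2 (PG m a b e) g -> GP m.+2 (PG m a' b' e') g) ->
  e = e' /\ forall k, k < m -> a k = a' k /\ b k = b' k.
Proof.
move/twisted_sub => h; split.
  have [f hf /agree_sym h1] := twisted_extend m a b e (delta [::]).
  have : twist m a b e false f = twist m a' b' e' false f by rewrite hf (h f hf).
  by rewrite !twist_delta_nil // => /addbI.
move=> k; rewrite -{1}(size_nseq k false) => hk.
have [f hf /agree_sym h1] := twisted_extend m a b e (delta (false :: nseq k false)).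
have E x : twist m a b e x f = twist m a' b' e' x f by rewrite hf (h f hf).
have := E false; have := E true; rewrite !(twist_delta _ _ _ _ hk h1) /= size_nseq.
by move=> /addbI-> /addbI->.
Qed.

Lemma Hdim_PG m a b e :
  Hdim_is (GP m.+2 (PG m a b e)) (Rminus 1 (Rdiv 2 (pow 2 (m.+2 - 1)))).
Proof.
apply/(Hdim_card (sub_PG m a b e) (essential_PG m a b e)) => //.
rewrite img_stab (img_HP (sub_PG m a b e) (essential_PG m a b e)).
by rewrite -img_stab card_stab_twisted.
Qed.

Lemma FC_Hdim_PG m H : FC_size m.+2 H ->
  Hdim_is H (Rminus 1 (Rdiv 2 (pow 2 (m.+2 - 1)))) ->
  exists (a b : m.-tuple bool) e,
    forall g, H g <-> GP m.+2 (PG m (nth false a) (nth false b) e) g.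
Proof.
move=> [[P [sP [eP hH]]] minH] /(Hdim_card sP eP hH isT) cP.
have minP : ~ defined_by m.+1 (GP m.+2 P).
  move=> [Q [sQ [eQ hQ]]]; apply: (minH m.+1 (ltnSn _)); exists Q; do 2!split=> //.
  by move=> g; rewrite hH.
have full := full_projection sP eP minP cP.
have fullP f : exists2 g, mk m.+2 g \in P & agree m.+1 f g.
  have : mk m.+1 f \in img m.+1 (HP P) by rewrite full; apply/AutdP; exists f.
  by case/imgP=> g /(_ [::]) hg /mk_eqP h; exists g => //; apply: agree_sym.
have topP : #|img m.+2 (stab m.+1 (fun f => mk m.+2 f \in P))| = 2 ^ (2 ^ m.+1 - 2).
  by rewrite img_stab (img_inP sP) -(img_HP sP eP) -img_stab.
(* Lifts in [P] of the single swaps; their section parities are the coefficients. *)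
have /fin_all_exists[q hq] (k : 'I_m) : exists q,
    mk m.+2 q \in P /\ agree m.+1 (delta (false :: nseq k false)) q.
  by have [q ? ?] := fullP (delta (false :: nseq k false)); exists q.
have [q0 hq0 h0] := fullP (delta [::]).
exists [tuple parity m (sh false (q k)) | k < m], [tuple parity m (sh true (q k)) | k < m].
exists (parity m (sh false q0)) => g; rewrite hH /GP.
have E := @classified m P sP fullP topP _ _ (parity m (sh false q0)) _ _.
rewrite -E //; first by exists q0.
move=> k hk; have [h1 h2] := hq (Ordinal hk).
by exists (q (Ordinal hk)); split; rewrite ?(nth_mktuple _ false (Ordinal hk)).
Qed.

Theorem theorem4 (d : nat) (hd : (2 <= d)%N) :
  exists F : 'I_(2 ^ (2 * d - 3)) -> subsetG,
    (forall i, FC_size d (F i) /\ Hdim_is (F i) (Rminus 1 (Rdiv 2 (pow 2 (d - 1))))) /\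
    (forall i j, (forall g, F i g <-> F j g) -> i = j) /\
    (forall H : subsetG, FC_size d H -> Hdim_is H (Rminus 1 (Rdiv 2 (pow 2 (d - 1)))) ->
       exists i, forall g, H g <-> F i g).
Proof.
(* Two tuples of length $m=d-2$ and one bit: $2^{2m+1}=2^{2d-3}$ parameters. *)
case: d hd => [|[|m]] // _; pose T : finType := (m.-tuple bool * m.-tuple bool * bool)%type.
have cT : #|T| = 2 ^ (2 * m.+2 - 3).
  rewrite !card_prod !card_tuple card_bool -expnD -expnSr; congr (_ ^ _).
  by rewrite mul2n !doubleS !subSS subn0 addnn.
pose p (i : 'I_(2 ^ (2 * m.+2 - 3))) : T := enum_val (cast_ord (esym cT) i).
exists (fun i => GP m.+2 (PG m (nth false (p i).1.1) (nth false (p i).1.2) (p i).2)).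
split; [|split].
- by move=> i; split; [exact: FC_PG | exact: Hdim_PG].
- move=> i j h; apply: (@cast_ord_inj _ _ (esym cT)); apply: enum_val_inj.
  rewrite -/(p i) -/(p j); have [] := PG_inj (fun g => proj1 (h g)).
  case: (p i) (p j) => [[a b] e] [[a' b'] e'] /= -> hab.
  by congr (_, _, _); apply: eq_from_tnth => k; rewrite !(tnth_nth false);
    have [] := hab k (ltn_ord k).
- move=> H hF hD; have [a [b [e hH]]] := FC_Hdim_PG hF hD.
  exists (cast_ord cT (enum_rank ((a, b, e) : T))) => g.
  by rewrite /p cast_ordK enum_rankK.
Qed.
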